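(* Let $R$ be a Hermite ring. Then the following are equivalent: $R$ is an elementary divisor ring; $R$ is an $E_2$ ring; $R$ is an $SE_2$ ring.
   Context: All rings are commutative with identity. Two matrices $B,C\in\mathbb{M}_{m\times n}(R)$ are equivalent if $C=MBN$ for some $M\in GL_m(R)$, $N\in GL_n(R)$. A matrix $B\in\mathbb{M}_{m\times n}(R)$ admits diagonal reduction if it is equivalent to a matrix whose off-diagonal entries are $0$ and whose diagonal entries $b_{1,1},\dots,b_{s,s}$, $s=\min\{m,n\}$, satisfy that $b_{i,i}$ divides $b_{i+1,i+1}$ for all $1\le i\le s-1$. $R$ is an elementary divisor ring (EDR) if all matrices (of all sizes) with entries in $R$ admit diagonal reduction. $R$ is a Hermite ring (in the sense of Kaplansky) if each $1\times 2$ matrix with entries in $R$ admits diagonal reduction; equivalently, every $v\in R^2$ has the form $ru$ with $r\in R$ and $u\in R^2$ unimodular (i.e., with entries generating the unit ideal). A matrix in $\mathbb{M}_2(R)$ is unimodular if its four entries generate the unit ideal; $Um(\mathbb{M}_2(R))$ is the set of such matrices. A matrix $A\in\mathbb{M}_2(R)$ is extendable if there exists $A^+\in SL_3(R)$ whose upper-left $2\times 2$ block is $A$; it is simply extendable if moreover $A^+$ can be chosen with $(3,3)$ entry $0$. $R$ is an $E_2$ ring (resp. $SE_2$ ring) if each matrix in $Um(\mathbb{M}_2(R))$ is extendable (resp. simply extendable). *)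

(* Defs.v *)
From mathcomp Require Import all_boot all_algebra.

Set Implicit Arguments.
Unset Strict Implicit.
Unset Printing Implicit Defensive.

Import GRing.Theory.
Local Open Scope ring_scope.

(* Rings are [comPzRingType]: commutative with identity, the zero ring being
   allowed. They carry no boolean unit predicate, so invertibility of matrices
   is expressed by a two-sided inverse rather than by [unitmx]. *)

Definition divides (R : comPzRingType) (a b : R) : Prop :=
  exists c : R, b = a * c.

Definition invertible_mx (R : comPzRingType) (n : nat) (M : 'M[R]_n) : Prop :=
  exists N : 'M[R]_n, M *m N = 1%:M /\ N *m M = 1%:M.

Definition equivalent_mx (R : comPzRingType) (m n : nat)
    (B C : 'M[R]_(m, n)) : Prop :=
  exists (M : 'M[R]_m) (N : 'M[R]_n),
    [/\ invertible_mx M, invertible_mx N & C = M *m B *m N].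

(* The diagonal of a rectangular matrix consists of the entries [D i j] whose
   row and column indices have the same value in [nat]. *)
Definition divisible_diag (R : comPzRingType) (m n : nat)
    (D : 'M[R]_(m, n)) : Prop :=
  is_diag_mx D /\
  forall (i i' : 'I_m) (j j' : 'I_n),
    i = j :> nat -> i' = j' :> nat -> i' = i.+1 :> nat ->
    divides (D i j) (D i' j').

Definition admits_diagonal_reduction (R : comPzRingType) (m n : nat)
    (B : 'M[R]_(m, n)) : Prop :=
  exists D : 'M[R]_(m, n), equivalent_mx B D /\ divisible_diag D.

Definition elementary_divisor_ring (R : comPzRingType) : Prop :=
  forall (m n : nat) (B : 'M[R]_(m, n)), admits_diagonal_reduction B.

Definition hermite_ring (R : comPzRingType) : Prop :=
  forall B : 'M[R]_(1, 2), admits_diagonal_reduction B.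

(* The entries generate the unit ideal: 1 is a linear combination of them. *)
Definition unimodular_mx (R : comPzRingType) (A : 'M[R]_2) : Prop :=
  exists C : 'M[R]_2, \sum_i \sum_j C i j * A i j = 1.

Definition extension_mx (R : comPzRingType) (A : 'M[R]_2)
    (Ap : 'M[R]_(2 + 1)) : Prop :=
  \det Ap = 1 /\ ulsubmx Ap = A.

Definition extendable (R : comPzRingType) (A : 'M[R]_2) : Prop :=
  exists Ap : 'M[R]_(2 + 1), extension_mx A Ap.

Definition simply_extendable (R : comPzRingType) (A : 'M[R]_2) : Prop :=
  exists Ap : 'M[R]_(2 + 1), extension_mx A Ap /\ Ap ord_max ord_max = 0.

Definition E2_ring (R : comPzRingType) : Prop :=
  forall A : 'M[R]_2, unimodular_mx A -> extendable A.

Definition SE2_ring (R : comPzRingType) : Prop :=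
  forall A : 'M[R]_2, unimodular_mx A -> simply_extendable A.

(* Main.v *)
Require Import Defs.
From mathcomp Require Import all_boot all_algebra ring.

(** Everything is phrased through the values [x *m A *m y] of the bilinear form
    of [A].  Expanding a bordered 3 x 3 determinant shows that a 2 x 2 matrix [A]
    is simply extendable iff its form takes the value [1]
    ([simply_extendableP]), and that if [A] is extendable then its form takes a
    value [1 - t * \det A] ([extendable_represents]).

    Over a Hermite ring every vector is a multiple of the first row, or of the
    first column, of an invertible matrix ([hermite_completion_row],
    [hermite_completion_col]).

    - E2 implies SE2.  If [x *m A *m y = 1 - t * \det A], write [x] and [y] as
      multiples of the first row of [M] and of the first column of [N].  With
      [B := M *m A *m N] this reads [s * B 0 0 + t' * \det B = 1] for some [s]
      and [t'].  Since [\det B] lies in the ideal generated by [B 0 0] and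
      [B 0 1], the first row of [B] is unimodular, so the form of [B], hence
      that of [A], takes the value [1].

    - SE2 implies elementary divisor.  A 2 x 2 matrix over a Hermite ring is a
      scalar multiple of a unimodular one, so under SE2 its form takes a value
      dividing all of its entries.  This property passes to all m x n matrices
      by induction on the number of rows ([hermite_attains_content]), each step
      being an instance of the 2 x 2 case.  Completing the vectors that attain
      the value to invertible matrices moves, up to equivalence, a common
      divisor of all the entries to the upper left corner; clearing the first
      row and column and inducting gives the diagonal reduction
      ([attains_content_EDR]).

    - Elementary divisor implies SE2.  The first diagonal entry of a diagonal
      reduction of a unimodular matrix is a value of its form and divides all
      of its entries, hence is a unit ([EDR_SE2]). *)

Set Implicit Arguments.
Unset Strict Implicit.
Unset Printing Implicit Defensive.

Import GRing.Theory.
Local Open Scope ring_scope.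

(** * Invertible matrices and equivalence *)

Lemma invertible_mx1 (R : comPzRingType) n : invertible_mx (1%:M : 'M[R]_n).
Proof. by exists 1%:M; rewrite mulmx1. Qed.

Lemma invertible_mxM (R : comPzRingType) n (A B : 'M[R]_n) :
  invertible_mx A -> invertible_mx B -> invertible_mx (A *m B).
Proof.
move=> [A' [AA' A'A]] [B' [BB' B'B]]; exists (B' *m A'); split.
  by rewrite mulmxA -(mulmxA A) BB' mulmx1.
by rewrite mulmxA -(mulmxA B') A'A mulmx1.
Qed.

Lemma invertible_mx_tr (R : comPzRingType) n (A : 'M[R]_n) :
  invertible_mx A -> invertible_mx A^T.
Proof. by case=> B [AB BA]; exists B^T; rewrite -!trmx_mul AB BA trmx1. Qed.

Lemma invertible_block_diag (R : comPzRingType) m n (A : 'M[R]_m) (B : 'M[R]_n) :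
  invertible_mx A -> invertible_mx B -> invertible_mx (block_mx A 0 0 B).
Proof.
move=> [A' [AA' A'A]] [B' [BB' B'B]]; exists (block_mx A' 0 0 B').
rewrite !mulmx_block !mulmx0 !mul0mx !addr0 !add0r.
by rewrite AA' A'A BB' B'B -scalar_mx_block.
Qed.

Lemma invertible_block_unitri (R : comPzRingType) m n (C : 'M[R]_(m, n)) :
  invertible_mx (block_mx 1%:M C 0 1%:M).
Proof.
exists (block_mx 1%:M (- C) 0 1%:M).
rewrite !mulmx_block !mulmx0 !mul0mx !mulmx1 !mul1mx !addr0 !add0r.
by rewrite addNr subrr -scalar_mx_block.
Qed.

Lemma equivalent_mx_trans (R : comPzRingType) m n (A B C : 'M[R]_(m, n)) :
  equivalent_mx A B -> equivalent_mx B C -> equivalent_mx A C.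
Proof.
move=> [M [N [iM iN ->]]] [P [Q [iP iQ ->]]]; exists (P *m M), (N *m Q).
by split; [exact: invertible_mxM | exact: invertible_mxM | rewrite !mulmxA].
Qed.

(** * Determinants of size 2 and 3 *)

Lemma det_mx22 (R : comPzRingType) (A : 'M[R]_2) :
  \det A = A 0 0 * A 1 1 - A 0 1 * A 1 0.
Proof.
rewrite (expand_det_row A 0) !big_ord_recl big_ord0 addr0 /cofactor !det_mx11.
rewrite !mxE /= expr0 expr1 mul1r mulN1r mulrN.
by congr (A _ _ * A _ _ - A _ _ * A _ _); apply/val_inj.
Qed.

(** The indices are given by their values in [nat], so that the formula applies
    to block matrices, whose indices are built with [lshift] and [rshift]. *)
Lemma det_mx33 (R : comPzRingType) (A : 'M[R]_(2 + 1)) (i j k : 'I_(2 + 1)) :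
  i = 0%N :> nat -> j = 1%N :> nat -> k = 2%N :> nat ->
  \det A = A i i * (A j j * A k k - A j k * A k j)
         - A i j * (A j i * A k k - A j k * A k i)
         + A i k * (A j i * A k j - A j j * A k i).
Proof.
move=> ei ej ek; rewrite (expand_det_row A i).
have -> : i = ord0 by exact/val_inj.
have -> : j = lift ord0 ord0 by exact/val_inj.
have -> : k = lift ord0 (lift ord0 ord0) by exact/val_inj.
rewrite !big_ord_recl big_ord0 addr0 /cofactor !det_mx22 !mxE /=.
rewrite expr0 expr1 expr2 !mulN1r !mulrN !opprK !mul1r addrA.
by congr (_ * (A _ _ * A _ _ - A _ _ * A _ _)
  - _ * (A _ _ * A _ _ - A _ _ * A _ _)
  + _ * (A _ _ * A _ _ - A _ _ * A _ _)); apply/val_inj.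
Qed.

(** * Extendability through values of the bilinear form *)

(** [d] is a value of the bilinear form of [A]; the 1 x 1 matrix [x *m A *m y] is
    compared with the scalar matrix [d%:M]. *)
Definition represents (R : comPzRingType) m n (A : 'M[R]_(m, n)) (d : R) :=
  exists (x : 'rV[R]_m) (y : 'cV[R]_n), x *m A *m y = d%:M.

Lemma bilinear22 (R : comPzRingType) (x : 'rV[R]_2) (A : 'M[R]_2) (y : 'cV[R]_2) :
  x *m A *m y = (x 0 0 * A 0 0 * y 0 0 + x 0 0 * A 0 1 * y 1 0
               + x 0 1 * A 1 0 * y 0 0 + x 0 1 * A 1 1 * y 1 0)%:M.
Proof.
rewrite [LHS]mx11_scalar; congr _%:M.
rewrite !mxE !big_ord_recl big_ord0 !mxE !big_ord_recl !big_ord0.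
have -> : lift ord0 ord0 = 1 :> 'I_2 by exact/val_inj.
ring.
Qed.

Lemma scalar_mx11_inj (R : comPzRingType) (a b : R) :
  a%:M = b%:M :> 'M_1 -> a = b.
Proof. by move/matrixP/(_ 0 0); rewrite !mxE. Qed.

Lemma row_mul_col (R : comPzRingType) m n p q (M : 'M[R]_(m, n))
    (A : 'M[R]_(n, p)) (N : 'M[R]_(p, q)) i j :
  row i M *m A *m col j N = ((M *m A *m N) i j)%:M.
Proof.
rewrite colE mulmxA -!row_mul -colE [LHS]mx11_scalar.
by rewrite mxE mxE.
Qed.

(** Bordering [A] by a column and a row that are, up to sign, [x] and [y] rotated
    by a quarter turn makes the bilinear form of [A] appear in the determinant. *)
Lemma det_border (R : comPzRingType) (A : 'M[R]_2) (x r : 'rV[R]_2)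
    (y c : 'cV[R]_2) (t : 'M[R]_1) :
    c 0 0 = - x 0 1 -> c 1 0 = x 0 0 -> r 0 0 = y 1 0 -> r 0 1 = - y 0 0 ->
  x *m A *m y = (\det (block_mx A c r t) - t 0 0 * \det A)%:M.
Proof.
move=> c0 c1 r0 r1.
pose i : 'I_(2 + 1) := lshift 1 0; pose j : 'I_(2 + 1) := lshift 1 1.
pose k : 'I_(2 + 1) := rshift 2 0.
rewrite (@det_mx33 _ _ i j k) // det_mx22 bilinear22; congr _%:M.
rewrite /i /j /k !(block_mxEul, block_mxEur, block_mxEdl, block_mxEdr) c0 c1 r0 r1.
ring.
Qed.

Lemma extendable_represents (R : comPzRingType) (A : 'M[R]_2) (Ap : 'M[R]_(2 + 1)) :
  extension_mx A Ap -> represents A (1 - Ap ord_max ord_max * \det A).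
Proof.
case=> det1 ulA; pose c := ursubmx Ap; pose r := dlsubmx Ap.
exists (\row_j if j == 0 then c 1 0 else - c 0 0).
exists (\col_j if j == 0 then - r 0 1 else r 0 0).
have -> : Ap ord_max ord_max = drsubmx Ap 0 0.
  by rewrite !mxE; congr (Ap _ _); apply/val_inj.
have := submxK Ap; rewrite ulA => Ap_block; rewrite -det1 -[in \det Ap]Ap_block.
by apply: det_border; rewrite !mxE /= ?opprK.
Qed.

Lemma simply_extendableP (R : comPzRingType) (A : 'M[R]_2) :
  simply_extendable A <-> represents A 1.
Proof.
split=> [[Ap [extA Ap0]] | [x [y xAy]]].
  by have := extendable_represents extA; rewrite Ap0 mul0r subr0.
pose c : 'cV[R]_2 := \col_j if j == 0 then - x 0 1 else x 0 0.
pose r : 'rV[R]_2 := \row_j if j == 0 then y 1 0 else - y 0 0.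
exists (block_mx A c r 0); split; last first.
  have -> : ord_max = rshift 2 0 :> 'I_(2 + 1) by exact/val_inj.
  by rewrite block_mxEdr mxE.
split; last by rewrite block_mxKul.
have := @det_border _ A x r y c 0; rewrite !mxE /= xAy mul0r subr0.
by move=> /(_ erefl erefl erefl erefl)/scalar_mx11_inj.
Qed.

(** * Completion of vectors over a Hermite ring *)

Lemma row_mxA11 (R : comPzRingType) n (a b : 'M[R]_1) (c : 'rV[R]_n) :
  row_mx a (row_mx b c) = @row_mx R 1 (1 + 1) n (row_mx a b) c.
Proof. by apply: etrans (@row_mxA R 1 1 1 n a b c) _; apply: castmx_id. Qed.

(** The defining property of Hermite rings extends from rows of length 2 to rows
    of any positive length: reduce the tail, then the first two entries. *)
Lemma hermite_row (R : comPzRingType) (hR : hermite_ring R) n (v : 'rV[R]_(1 + n)) :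
  exists (d : R) (N : 'M[R]_(1 + n)), invertible_mx N /\ v *m N = row_mx d%:M 0.
Proof.
elim: n v => [|n IHn] v.
  exists (v 0 0), 1%:M; split; first exact: invertible_mx1.
  rewrite mulmx1 [LHS]mx11_scalar; apply/rowP=> i; rewrite !ord1 !mxE.
  by case: splitP => // k; rewrite ord1 !mxE.
have [d [N [iN vN]]] := IHn (rsubmx v).
pose w : 'rV[R]_(1 + 1) := row_mx (lsubmx v) d%:M.
have [D [[M [P [[M' [MM' M'M]] iP defD]]] [/is_diag_mxP diagD _]]] := hR w.
pose e := (M' *m lsubmx (D : 'rV[R]_(1 + 1))) 0 0.
have wP : w *m P = row_mx e%:M 0.
  rewrite /e -mx11_scalar.
  have -> : w *m P = M' *m D by rewrite defD -mulmxA mulmxA M'M mul1mx.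
  have := @mul_mx_row R 1 1 1 1 M' (@lsubmx _ 1 1 1 D) (@rsubmx _ 1 1 1 D).
  rewrite hsubmxK => M'D; apply: (etrans M'D); congr row_mx.
  rewrite [rsubmx _](_ : _ = 0) ?mulmx0 //.
  by apply/rowP=> i; rewrite !mxE diagD // !ord1.
pose Q1 : 'M[R]_(1 + (1 + n)) := block_mx 1%:M 0 0 N.
pose Q2 : 'M[R]_(1 + (1 + n)) := @block_mx R (1 + 1) n (1 + 1) n P 0 0 1%:M.
exists e, (Q1 *m Q2); split.
  apply: invertible_mxM.
    by apply: invertible_block_diag => //; exact: invertible_mx1.
  apply: (@invertible_block_diag R (1 + 1) n P) => //; exact: invertible_mx1.
have vQ1 : v *m Q1 = row_mx w (0 : 'rV_n).
  rewrite /w -row_mxA11.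
  rewrite -[v in LHS](@hsubmxK _ 1 1) (mul_row_block (lsubmx v)).
  by rewrite !mulmx0 mulmx1 addr0 add0r vN.
rewrite mulmxA vQ1; apply: etrans (mul_row_block w 0 P 0 0 1%:M) _.
rewrite !mulmx0 mul0mx !addr0 wP.
by apply: etrans (esym (row_mxA11 _ _ _)) _; rewrite row_mx0.
Qed.

Lemma hermite_completion_row (R : comPzRingType) (hR : hermite_ring R) n
    (v : 'rV[R]_n.+1) :
  exists (d : R) (N : 'M[R]_n.+1), invertible_mx N /\ v = d *: row ord0 N.
Proof.
have [d [N [[N' [NN' N'N]] vN]]] := hermite_row hR (v : 'rV_(1 + n)).
exists d, N'; split; first by exists N.
have -> : v = v *m N *m N' by rewrite -mulmxA NN' mulmx1.
rewrite vN rowE scalemxAl; congr (_ *m _).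
apply/rowP=> i; rewrite !mxE; case: splitP => k ik.
  have -> : i = ord0 by apply/val_inj; apply: etrans ik _; rewrite ord1.
  by rewrite !mxE ord1 mulr1.
have /negbTE i0 : i != ord0 by apply/eqP=> i0; move: ik; rewrite i0.
by rewrite i0 andbF mxE mulr0.
Qed.

Lemma hermite_completion_col (R : comPzRingType) (hR : hermite_ring R) n
    (v : 'cV[R]_n.+1) :
  exists (d : R) (N : 'M[R]_n.+1), invertible_mx N /\ v = d *: col ord0 N.
Proof.
have [d [N [iN vN]]] := hermite_completion_row hR v^T.
exists d, N^T; split; first exact: invertible_mx_tr.
by rewrite -tr_row -[v]trmxK vN linearZ.
Qed.

(** The generator [v *m q] of the ideal of entries of [v]; [Q] holds the quotients. *)
Lemma hermite_bezout (R : comPzRingType) (hR : hermite_ring R) n (v : 'rV[R]_n) :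
  exists (q : 'cV[R]_n) (Q : 'rV[R]_n), v = v *m q *m Q.
Proof.
case: n v => [|n] v; first by exists 0, 0; rewrite !thinmx0.
have [d [N [[N' [NN' _]] ->]]] := hermite_completion_row hR v.
exists (col ord0 N'), (row ord0 N).
rewrite -[row ord0 N in X in _ = X *m _]mulmx1 -!scalemxAl row_mul_col mulmx1 NN' mxE.
by rewrite eqxx mul1mx.
Qed.

(** * Extendable, simply extendable, elementary divisor *)

Lemma extendable_simply_extendable (R : comPzRingType) (hR : hermite_ring R)
    (A : 'M[R]_2) : extendable A -> simply_extendable A.
Proof.
move=> [Ap /extendable_represents[x [y]]]; set t := Ap _ _.
have [e [M [[M' [MM' _]] ->]]] := hermite_completion_row hR x.
have [d [N [[N' [NN' _]] ->]]] := hermite_completion_col hR y => xAy.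
apply/simply_extendableP; pose B := M *m A *m N.
have xAyB : e * d * B 0 0 = 1 - t * \det A.
  apply: scalar_mx11_inj; rewrite -xAy -scalemxAr -!scalemxAl row_mul_col.
  by rewrite !scale_scalar_mx mulrA (mulrC d).
pose t' := t * \det M' * \det N'.
have tB : t' * \det B = t * \det A.
  rewrite /t' /B !det_mulmx.
  transitivity (t * \det A * (\det M * \det M') * (\det N * \det N')).
    by ring.
  by rewrite -!det_mulmx MM' NN' !det1 !mulr1.
pose z : 'cV[R]_2 := \col_j if j == 0 then e * d + t' * B 1 1 else - t' * B 1 0.
(* The vector [z] satisfies
   [row 0 B *m z = e * d * B 0 0 + t' * \det B = 1]. *)
exists (row ord0 M), (N *m z).
have -> : row ord0 M *m A *m (N *m z) = row ord0 1%:M *m B *m z.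
  by rewrite row1 /B rowE !mulmxA.
clearbody B; rewrite bilinear22 !mxE /=; congr _%:M.
transitivity (e * d * B 0 0 + t' * \det B); last by rewrite xAyB tB subrK.
by rewrite det_mx22; ring.
Qed.

(** A common divisor of the entries of a matrix equivalent to [A] divides the
    entries of [A]. *)
Lemma divides_mx_invertible (R : comPzRingType) m n (M : 'M[R]_m) (N : 'M[R]_n)
    (A Q : 'M[R]_(m, n)) d :
  invertible_mx M -> invertible_mx N -> M *m A *m N = d *: Q ->
  exists P, A = d *: P.
Proof.
move=> [M' [_ M'M]] [N' [NN' _]] MAN; exists (M' *m Q *m N').
rewrite scalemxAl scalemxAr -MAN -!mulmxA NN' mulmx1 !mulmxA M'M mul1mx //.
Qed.

Lemma unimodular_mx_scale (R : comPzRingType) (A Q : 'M[R]_2) (a : R) :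
  unimodular_mx A -> A = a *: Q -> exists b, a * b = 1.
Proof.
move=> [C sumCA] defA; exists (\sum_i \sum_j C i j * Q i j).
rewrite -sumCA defA mulr_sumr; apply: eq_bigr => i _; rewrite mulr_sumr.
by apply: eq_bigr => j _; rewrite !mxE mulrCA.
Qed.

Lemma EDR_SE2 (R : comPzRingType) :
  elementary_divisor_ring R -> SE2_ring R.
Proof.
move=> edR A uniA; apply/simply_extendableP.
have [D [[M [N [iM iN defD]]] [/is_diag_mxP diagD divD]]] := edR 2 2 A.
have [b D11] := divD 0 1 0 1 erefl erefl erefl.
have [Q defA] : exists Q, A = D 0 0 *: Q.
  (* [D 1 1 = D 0 0 * b], so [D] is [D 0 0] times [diag(1, b)]. *)
  pose E : 'M[R]_2 :=
    \matrix_(i, j) (if i == j then if i == 0 then 1 else b else 0).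
  apply: (divides_mx_invertible (Q := E) iM iN).
  rewrite -defD; apply/matrixP=> i j; rewrite !mxE.
  case: eqVneq => [<-{j} | ij]; last by rewrite diagD ?mulr0.
  case: eqVneq => [-> | i0]; first by rewrite mulr1.
  have -> : i = 1 by apply/val_inj; case: i i0 => [[|[|]]].
  by [].
have [c ac] := unimodular_mx_scale uniA defA.
exists (row 0 M), (c *: col 0 N).
by rewrite -scalemxAr row_mul_col -defD scale_scalar_mx mulrC ac.
Qed.

(** * Values dividing all the entries, and diagonal reduction *)

(** Some value of the bilinear form of [A] divides all the entries of [A], so that
    it generates the ideal of the entries. *)
Definition attains_content (R : comPzRingType) m n (A : 'M[R]_(m, n)) :=
  exists (d : R) (Q : 'M[R]_(m, n)), represents A d /\ A = d *: Q.

Lemma attains_content22 (R : comPzRingType) (hR : hermite_ring R)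
    (hSE : SE2_ring R) (A : 'M[R]_2) : attains_content A.
Proof.
(* [A] is [d] times a unimodular matrix: flatten [A] and complete the row. *)
have [d [N [[N' [NN' _]] vA]]] := @hermite_completion_row R hR 3 (mxvec A).
pose q : 'rV[R]_(2 * 2) := row ord0 N; pose r : 'cV[R]_(2 * 2) := col ord0 N'.
have qr : q *m r = 1%:M by rewrite -[q]mulmx1 row_mul_col mulmx1 NN' mxE.
have defA : A = d *: vec_mx q.
  by rewrite -linearZ -[RHS]/(vec_mx (d *: q)) -[d *: q]vA mxvecK.
have /hSE/simply_extendableP[x [y xQy]] : unimodular_mx (vec_mx q).
  exists (vec_mx r^T); move/matrixP/(_ 0 0): qr; rewrite !mxE eqxx mulr1n => <-.
  rewrite pair_bigA (reindex _ (curry_mxvec_bij 2 2)) /=.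
  by apply: eq_bigr => -[i j] _; rewrite !mxE mulrC.
exists d, (vec_mx q); split=> //; exists x, y.
by rewrite defA -scalemxAr -scalemxAl xQy scale_scalar_mx mulr1.
Qed.

(** Given the first column of [N], some column [v] is such that [r *m col ord0 N]
    and [r *m v] generate the ideal of the entries of [r]: take for [v] the
    combination of the other columns of [N] on which [r] takes a value generating
    the ideal of the remaining entries of [r *m N]. *)
Lemma hermite_second_column (R : comPzRingType) (hR : hermite_ring R) n
    (r : 'rV[R]_n.+1) (N : 'M[R]_n.+1) : invertible_mx N ->
  exists v : 'cV[R]_n.+1, forall (h : R) (a b : 'M[R]_1),
    r *m col ord0 N = h *: a -> r *m v = h *: b -> exists Q, r = h *: Q.
Proof.
move=> [N' [NN' _]]; pose s : 'rV[R]_(1 + n) := r *m N.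
have [q [Q sqQ]] := hermite_bezout hR (rsubmx s).
exists (N *m (col_mx 0 q : 'cV_(1 + n))) => h a b ru rv.
exists ((row_mx a (b *m Q) : 'rV_(1 + n)) *m N').
have -> : r = s *m N' by rewrite -mulmxA NN' mulmx1.
rewrite scalemxAl scale_row_mx; congr (_ *m _); rewrite -[s]hsubmxK; congr row_mx.
  rewrite -ru colE mulmxA -colE; apply/rowP=> i; rewrite ord1 [LHS]mxE [RHS]mxE.
  by congr ((r *m N) _ _); apply/val_inj.
rewrite sqQ scalemxAl -rv; congr (_ *m _).
rewrite mulmxA -[r *m N]/s -[in RHS](hsubmxK s).
apply: etrans _ (esym (mul_row_col (lsubmx s) (rsubmx s) 0 q)).
by rewrite mulmx0 add0r.
Qed.

Lemma hermite_attains_content (R : comPzRingType) (hR : hermite_ring R)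
    (hSE : SE2_ring R) m n (A : 'M[R]_(m, n)) : attains_content A.
Proof.
elim: m A => [|m IHm] A.
  by exists 0, 0; split; [exists 0, 0 | ]; rewrite ?mulmx0 ?scale0r ?flatmx0 ?raddf0.
case: n => [|n] in A IHm *.
  by exists 0, 0; split; [exists 0, 0 | ]; rewrite ?mulmx0 ?scale0r ?thinmx0 ?raddf0.
pose r : 'rV[R]_n.+1 := @usubmx _ 1 m n.+1 A.
pose B : 'M[R]_(m, n.+1) := @dsubmx _ 1 m n.+1 A.
have [d1 [Q1 [[x1 [y1 x1By1]] defB]]] := IHm B.
have [e [N [iN y1N]]] := hermite_completion_col hR y1.
have [v vP] := hermite_second_column hR r iN.
(* Compress [A] to the 2 x 2 matrix of the values of the rows [r] and [x1 *m B] on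
   the columns [u] and [v].  Its entry [x1 *m B *m u] divides [d1], hence all of
   [B], and its first row generates the ideal of the entries of [r]. *)
pose u := col ord0 N.
pose X : 'M[R]_(1 + 1, 1 + m) := block_mx 1%:M 0 0 x1.
pose Y : 'M[R]_(n.+1, 1 + 1) := row_mx u v.
have [d [Q [[x2 [y2 dP]] defQ]]] := attains_content22 hR hSE (X *m A *m Y).
have XAY : X *m A *m Y = block_mx (r *m u) (r *m v) (x1 *m B *m u) (x1 *m B *m v).
  rewrite -[A](@vsubmxK _ 1 m) mul_block_col !mul0mx mul1mx addr0 add0r.
  exact: mul_col_row.
pose Q' : 'M[R]_(1 + 1) := Q.
have := etrans (esym XAY) defQ; rewrite -[d *: Q]/(d *: Q') -(submxK Q').
rewrite scale_block_mx => /eq_block_mx[ru rv x1Bu _].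
have [Qr defr] := vP d _ _ ru rv.
pose c := e * dlsubmx Q' 0 0.
have d1E : d1 = d * c.
  apply: scalar_mx11_inj; rewrite -x1By1 y1N -scalemxAr -/u x1Bu.
  by rewrite [dlsubmx _]mx11_scalar !scale_scalar_mx mulrCA.
exists d, (col_mx Qr (c *: Q1)); split.
  by exists (x2 *m X), (Y *m y2); rewrite -dP !mulmxA.
apply: etrans (esym (@vsubmxK _ 1 m _ A)) _.
apply: etrans _ (esym (scale_col_mx d Qr (c *: Q1))).
by rewrite scalerA -d1E -defr -defB.
Qed.

Lemma attains_content_EDR (R : comPzRingType) (hR : hermite_ring R) :
  (forall m n (A : 'M[R]_(m, n)), attains_content A) -> elementary_divisor_ring R.
Proof.
move=> hcont; elim=> [|m IHm] n B.
  exists B; split; last by split; [apply/is_diag_mxP=> -[] | move=> []].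
  by exists 1%:M, 1%:M; rewrite mul1mx mulmx1; split=> //; apply: invertible_mx1.
case: n => [|n] in B *.
  exists B; split; last by split; [apply/is_diag_mxP=> ? [] | move=> ? ? []].
  by exists 1%:M, 1%:M; rewrite mul1mx mulmx1; split=> //; apply: invertible_mx1.
have [d [Q [[x [y xBy]] defB]]] := hcont _ _ B.
have [e [M [iM xM]]] := hermite_completion_row hR x.
have [f [N [iN yN]]] := hermite_completion_col hR y.
pose C : 'M[R]_(1 + m, 1 + n) := M *m B *m N.
pose c := C ord0 ord0.
have dE : d = c * (e * f).
  apply: scalar_mx11_inj; rewrite -xBy xM yN -scalemxAr -!scalemxAl row_mul_col.
  by rewrite !scale_scalar_mx; congr _%:M; rewrite -/c; ring.
have [P CP] : exists P : 'M[R]_(1 + m, 1 + n), C = c *: P.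
  by exists ((e * f) *: (M *m Q *m N)); rewrite /C defB -scalemxAr -scalemxAl dE scalerA.
pose w := ursubmx P; pose z := dlsubmx P.
have CE : C = block_mx c%:M (c *: w) (c *: z) (c *: drsubmx P).
  rewrite -[C]submxK; congr block_mx;
    try by rewrite CP; apply/matrixP=> i j; rewrite !mxE.
  rewrite [LHS]mx11_scalar; congr _%:M; rewrite mxE mxE.
  by congr (C _ _); apply/val_inj.
have [D [[M1 [N1 [iM1 iN1 defD]]] [diagD divD]]] := IHm _ (drsubmx P - z *m w).
pose D' : 'M[R]_(1 + m, 1 + n) := block_mx c%:M 0 0 (c *: D).
exists D'; split.
  apply: (@equivalent_mx_trans _ _ _ _ C); first by exists M, N.
  apply: (@equivalent_mx_trans _ _ _ _ (block_mx c%:M 0 0 (c *: (drsubmx P - z *m w)))).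
    (* Row and column operations with pivot [c]. *)
    exists (block_mx 1%:M 0 (- z) 1%:M), (block_mx 1%:M (- w) 0 1%:M).
    split; [ | exact: invertible_block_unitri | ].
      have := invertible_mx_tr (invertible_block_unitri (- z)^T).
      by rewrite tr_block_mx !trmx1 trmx0 trmxK.
    rewrite CE !mulmx_block !mul1mx !mulmx1 !mul0mx !mulmx0 !addr0 ?add0r.
    rewrite mul_scalar_mx scalerN addNr mul_mx_scalar scalerN addNr mul0mx add0r.
    by rewrite mulNmx -scalemxAr scalerBr addrC.
  exists (block_mx 1%:M 0 0 M1), (block_mx 1%:M 0 0 N1).
  split; try by apply: invertible_block_diag => //; apply: invertible_mx1.
  rewrite !mulmx_block !mul1mx !mulmx1 !mul0mx !mulmx0 !addr0 !add0r ?mul0mx.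
  by rewrite -scalemxAr -scalemxAl -defD.
split.
  apply/is_diag_mxP=> i j; rewrite /D'.
  have [i1 ->|i1 ->] := @split_ordP 1 m i; have [j1 ->|j1 ->] := @split_ordP 1 n j.
  - by rewrite !ord1.
  - by rewrite (@block_mxEur R 1 m 1 n) mxE.
  - by rewrite (@block_mxEdl R 1 m 1 n) mxE.
  rewrite (@block_mxEdr R 1 m 1 n) mxE /= !add1n eqSS => ij.
  by move/is_diag_mxP: diagD => ->; rewrite ?mulr0.
move=> i i' j j'; rewrite /D'.
have [k ->|i1' ->] := @split_ordP 1 m i'; first by rewrite ord1.
have [k ->|j1' ->] := @split_ordP 1 n j'; first by rewrite ord1.
rewrite (@block_mxEdr R 1 m 1 n) /= !add1n => ij [i'j'] [i'i].
have [i1 Ei|i1 Ei] := @split_ordP 1 m i; have [j1 Ej|j1 Ej] := @split_ordP 1 n j;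
  move: ij i'i; rewrite {}Ei {}Ej.
- by rewrite (@block_mxEul R 1 m 1 n) !ord1 !mxE => _ _; exists (D i1' j1').
- by rewrite ord1.
- by rewrite !ord1.
rewrite (@block_mxEdr R 1 m 1 n) !mxE /= !add1n => -[ij] i'i.
have [b ->] := divD i1 i1' j1 j1' ij i'j' i'i.
by exists b; rewrite mulrA.
Qed.

Theorem corollary1p8 (R : comPzRingType) (hR : hermite_ring R) :
  (elementary_divisor_ring R <-> E2_ring R) /\
  (E2_ring R <-> SE2_ring R).
Proof.
have SE2_E2 : SE2_ring R -> E2_ring R.
  by move=> hSE A /hSE[Ap [extA _]]; exists Ap.
have E2_SE2 : E2_ring R -> SE2_ring R.
  by move=> hE A /hE; apply: extendable_simply_extendable.
split; split=> //; first by move=> /EDR_SE2.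
move=> /E2_SE2 hSE; apply: attains_content_EDR => // m n A.
exact: hermite_attains_content.
Qed.
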